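(* Let $d,l\ge 1$ be integers, let $n_1,\dots,n_d$ be positive integers, and let $M\subset\mathcal{P}([d])$ be non-empty. If $A\subset[n_1]\times\dots\times[n_d]$ satisfies $\mathrm{c}_M(A)\ge |M|\,l$, then there exist $X_1\subset[n_1],\dots,X_d\subset[n_d]$, each of size at most $l$, such that \[\mathrm{c}_M\big(A\cap(X_1\times\dots\times X_d)\big)\ge l.\]
   Context: $[k]=\{1,\dots,k\}$. For $B \subset [d]$, a $B$-subspace is a maximal subset $S$ of $[n_1]\times\dots\times[n_d]$ such that $x_i = y_i$ whenever $x,y\in S$ and $i \notin B$. For non-empty $M\subset\mathcal{P}([d])$, an $M$-subspace is a $B$-subspace for some $B\in M$. The $M$-covering number $\mathrm{c}_M(A)$ of $A\subset[n_1]\times\dots\times[n_d]$ is the smallest nonnegative integer $k$ such that $A$ is contained in a union of $k$ $M$-subspaces. *)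

(* Defs.v *)
From mathcomp Require Import all_boot.

Set Implicit Arguments.
Unset Strict Implicit.
Unset Printing Implicit Defensive.

(* The side [n_i] = {1, ..., n_i} is rendered by 'I_(n i) = {0, ..., n_i - 1}
   and the set of directions [d] by 'I_d. *)
Notation grid n := {dffun forall i, 'I_(n i)}.

Section Covering.

Variables (d : nat) (n : 'I_d -> nat).

Definition agree_off (B : {set 'I_d}) (S : {set grid n}) : bool :=
  [forall x in S, forall y in S, forall (i | i \notin B), x i == y i].

Definition is_subspace (B : {set 'I_d}) (S : {set grid n}) : bool :=
  maxset (agree_off B) S.

Definition is_Msubspace (M : {set {set 'I_d}}) (S : {set grid n}) : bool :=
  [exists B in M, is_subspace B S].

Definition coverable (M : {set {set 'I_d}}) (A : {set grid n}) : pred nat :=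
  fun k => [exists F : {set {set grid n}},
    [&& #|F| == k, [forall S in F, is_Msubspace M S] & A \subset cover F]].

Lemma coverable_ex (M : {set {set 'I_d}}) (A : {set grid n}) :
  M != set0 -> exists k, coverable M A k.
Proof.
case/set0Pn=> B BM; pose F := [set S : {set grid n} | is_Msubspace M S].
exists #|F|; apply/existsP; exists F; rewrite eqxx /=; apply/andP; split.
  by apply/forall_inP => S; rewrite inE.
apply/subsetP => x _.
have agx : agree_off B [set x].
  apply/forall_inP => y /set1P ->; apply/forall_inP => z /set1P ->.
  by apply/forall_inP => i _.
have [S maxS] := maxset_exists agx; rewrite sub1set => xS.
apply/bigcupP; exists S => //; rewrite inE.
by apply/existsP; exists B; rewrite BM.
Qed.

(* Without M != set0 no finite cover need exist. *)
Definition covering_number (M : {set {set 'I_d}}) (M_neq0 : M != set0)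
  (A : {set grid n}) : nat := ex_minn (coverable_ex A M_neq0).

End Covering.

(* Main.v *)
Require Import Defs.
From mathcomp Require Import all_boot.

(* Take a maximal set P of points of A no two of which lie in a common
   M-subspace.  By maximality every point of A lies in one of the |M| |P|
   M-subspaces through the points of P, so |P| >= l.  Any l points of P span a
   box with sides of size at most l, and an M-subspace contains at most one of
   them. *)

Section Scattered.

Set Implicit Arguments.
Unset Strict Implicit.

Variables (d : nat) (n : 'I_d -> nat) (M : {set {set 'I_d}}).
Implicit Types (B : {set 'I_d}) (A P S : {set grid n}) (x y : grid n).

(** An explicit form of the only [B]-subspace through [x], which avoids handling maximal sets. *)
Definition flat B x : {set grid n} :=
  [set y : grid n | [forall (i | i \notin B), x i == y i]].

Lemma mem_flat B x : x \in flat B x.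
Proof. by rewrite inE; apply/forall_inP. Qed.

Lemma flat_subspace B x : is_subspace B (flat B x).
Proof.
apply/maxsetP; split=> [|S /forall_inP agS sub_S].
  apply/forall_inP=> y; rewrite inE => /forall_inP xy.
  apply/forall_inP=> z; rewrite inE => /forall_inP xz.
  by apply/forall_inP=> i iB; rewrite -(eqP (xy i iB)) xz.
apply/eqP; rewrite eqEsubset sub_S andbT; apply/subsetP=> y yS.
have /forall_inP agx := agS x (subsetP sub_S x (mem_flat B x)).
by rewrite inE agx.
Qed.

Definition scattered P : bool :=
  [forall x in P, forall y in P, [exists B in M, y \in flat B x] ==> (x == y)].

Lemma scatteredP P :
  reflect (forall x y B, x \in P -> y \in P -> B \in M -> y \in flat B x ->
             x = y)
          (scattered P).
Proof.
apply: (iffP forall_inP) => [scP x y B xP yP BM yx | scP x xP].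
  have /forall_inP/(_ y yP)/implyP scx := scP x xP.
  by apply/eqP/scx/exists_inP; exists B.
apply/forall_inP=> y yP; apply/implyP=> /exists_inP[B BM yx].
by apply/eqP; apply: scP yx.
Qed.

Lemma flat_sym B x y : (y \in flat B x) = (x \in flat B y).
Proof. by rewrite !inE; apply: eq_forallb => i; rewrite eq_sym. Qed.

(** Bridge from flats to arbitrary [M]-subspaces: two points of [S] agree off its direction [B], so
    [y] lies in [flat B x]. *)
Lemma Msubspace_scattered P S x y :
  scattered P -> is_Msubspace M S -> x \in P -> y \in P ->
  x \in S -> y \in S -> x = y.
Proof.
move=> /scatteredP scP /exists_inP[B BM /maxsetp/forall_inP agS] xP yP xS yS.
apply: (scP x y B) => //; rewrite inE.
by have /forall_inP/(_ y yS) := agS x xS.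
Qed.

(** Pigeonhole: sending each point of [P] to a member of the cover that contains it is injective. *)
Lemma scattered_leq_coverable P A k :
  scattered P -> P \subset A -> coverable M A k -> #|P| <= k.
Proof.
move=> scP PA /existsP[F /and3P[/eqP <- /forall_inP MF AF]].
(* The default [set0] is never reached on [P], since [F] covers [A]. *)
pose f x := odflt set0 [pick S in F | x \in S].
have fP x : x \in P -> (f x \in F) && (x \in f x).
  move=> xP; have /bigcupP[S SF xS] := subsetP AF x (subsetP PA x xP).
  by rewrite /f; case: pickP => [//|/(_ S)]; rewrite /= SF xS.
have f_inj : {in P &, injective f}.
  move=> x y xP yP eqf; have /andP[fF xf] := fP x xP.
  have /andP[_] := fP y yP; rewrite -eqf => yf.
  exact: (Msubspace_scattered scP (MF _ fF)).
rewrite -(card_in_imset f_inj); apply/subset_leq_card/subsetP=> S.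
by case/imsetP=> x /fP/andP[fF _] ->.
Qed.

Lemma covering_number_leq_max_scattered (M_neq0 : M != set0) A P :
  maxset (fun Q : {set grid n} => scattered Q && (Q \subset A)) P ->
  covering_number M_neq0 A <= #|M| * #|P|.
Proof.
case/maxsetP=> /andP[scP PA] maxP.
pose F := [set flat B x | B in M, x in P].
have cardF : #|F| <= #|M| * #|P|.
  by rewrite /F curry_imset2X -cardsX leq_imset_card.
(* Different pairs may give the same flat, so minimality is applied at the exact size [#|F|]. *)
apply: leq_trans cardF; rewrite /covering_number; case: ex_minnP => k _ -> //.
apply/existsP; exists F; rewrite eqxx /=; apply/andP; split.
  apply/forall_inP=> _ /imset2P[B x BM _ ->].
  by apply/exists_inP; exists B; rewrite ?flat_subspace.
apply/subsetP=> a aA.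
suff /exists_inP[B BM /exists_inP[x xP ax]] :
    [exists B in M, exists x in P, a \in flat B x].
  by apply/bigcupP; exists (flat B x) => //; apply: imset2_f.
have [aP | aNP] := boolP (a \in P).
  case/set0Pn: M_neq0 => B BM; apply/exists_inP; exists B => //.
  by apply/exists_inP; exists a; rewrite ?mem_flat.
(* If no flat through [P] contains [a], then [a |: P] is still scattered, and maximality puts [a] in
   [P]. *)
apply: contraNT aNP => /exists_inPn noflat.
have far B x : B \in M -> x \in P -> a \notin flat B x.
  by move=> BM xP; have /exists_inPn := noflat B BM; apply.
rewrite -(maxP (a |: P)) ?setU11 ?subsetUr // subUset sub1set aA PA !andbT.
apply/scatteredP=> x y B /setU1P[-> | xP] /setU1P[-> | yP] // BM xy.
- by move: (far B y BM yP); rewrite flat_sym xy.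
- by move: (far B x BM xP); rewrite xy.
- exact: (scatteredP _ scP) BM xy.
Qed.

End Scattered.

Theorem theorem2p3 (d l : nat) (n : 'I_d -> nat) (M : {set {set 'I_d}})
    (M_neq0 : M != set0) (A : {set grid n}) :
  0 < d -> 0 < l -> (forall i, 0 < n i) ->
  #|M| * l <= covering_number M_neq0 A ->
  exists X : forall i, {set 'I_(n i)},
    (forall i, #|X i| <= l) /\
    l <= covering_number M_neq0 (A :&: setXn X).
Proof.
move=> _ _ _ cA.
have sc0 : scattered M (set0 : {set grid n}) && (set0 \subset A).
  by rewrite sub0set andbT; apply/scatteredP=> x y B; rewrite inE.
have [P maxP _] :=
  maxset_exists (P := fun Q : {set grid n} => scattered M Q && (Q \subset A))
    sc0.
have /andP[/scatteredP scP PA] := maxsetp maxP.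
(* Cancel [#|M|], positive as [M] is non-empty, in [#|M| * l <= #|M| * #|P|]. *)
have lP : l <= #|P|.
  rewrite -(@leq_pmul2l #|M|) ?card_gt0 //.
  exact: leq_trans cA (covering_number_leq_max_scattered _ maxP).
(* Keep exactly [l] points: the sides of the box are the coordinate projections of [Q], so [#|Q|]
   bounds their sizes as well as the covering number. *)
have /card_geqP[s [s_uniq s_size sP]] := lP.
pose Q := [set x in s].
have cardQ : #|Q| = l by rewrite cardsE -s_size; apply/card_uniqP.
have QP x : x \in Q -> x \in P by rewrite inE; apply: sP.
exists (fun i => [set (x : grid n) i | x in Q]); split=> [i|].
  by rewrite -cardQ leq_imset_card.
rewrite /covering_number; case: ex_minnP => k cov_k _; rewrite -cardQ.
apply: scattered_leq_coverable cov_k.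
  by apply/scatteredP=> x y B /QP xP /QP yP; apply: scP.
apply/subsetP=> x xQ; rewrite inE (subsetP PA) ?QP //=.
by apply/setXnP=> i; apply: imset_f.
Qed.
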